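(* For every connected graph $G$ that is $(P_8,C_8)$-free, $\gamma_c(G)/\gamma(G) \le 2$.
   Context: All graphs are finite and simple. A dominating set of a graph $G$ is a vertex subset $X$ such that every vertex not in $X$ has a neighbor in $X$; $\gamma(G)$ is the minimum size of a dominating set. A connected dominating set is a dominating set $X$ such that the induced subgraph $G[X]$ is connected; for connected $G$, $\gamma_c(G)$ is the minimum size of a connected dominating set. $P_k$ denotes the path on $k$ vertices and $C_k$ the cycle on $k$ vertices. $G$ is $(H_1,H_2)$-free if it contains neither $H_1$ nor $H_2$ as an induced subgraph. *)

(* Defs.v *)
From mathcomp Require Import all_boot all_order all_algebra.

Set Implicit Arguments.
Unset Strict Implicit.
Unset Printing Implicit Defensive.

Record sgraph := SGraph {
  vertex :> finType;
  edge : rel vertex;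
  edge_sym : symmetric edge;
  edge_irrefl : irreflexive edge }.

Arguments edge {G} x y : rename.

(* The null graph is not connected. *)
Definition is_connected (G : sgraph) : bool :=
  (0 < #|G|) && [forall x : G, forall y : G, connect edge x y].

Section Induced.
Variables (G : sgraph) (X : {set G}).

Definition induced_edge : rel {x : G | x \in X} :=
  fun x y => edge (val x) (val y).

Lemma induced_sym : symmetric induced_edge.
Proof. by move=> x y; apply: edge_sym. Qed.

Lemma induced_irrefl : irreflexive induced_edge.
Proof. by move=> x; apply: edge_irrefl. Qed.

Definition induced : sgraph := SGraph induced_sym induced_irrefl.

End Induced.

Section PathCycle.
Variable k : nat.

Definition path_edge : rel 'I_k := fun i j => (i.+1 == j) || (j.+1 == i).

Lemma path_sym : symmetric path_edge.
Proof. by move=> i j; rewrite /path_edge orbC. Qed.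

Lemma path_irrefl : irreflexive path_edge.
Proof. by move=> i; rewrite /path_edge orbb gtn_eqF. Qed.

Definition path_graph : sgraph := SGraph path_sym path_irrefl.

(* This is a cycle for k >= 3; the conjunct [i != j] only matters for k = 1. *)
Definition cycle_edge : rel 'I_k :=
  fun i j => (i != j) && ((i.+1 %% k == j) || (j.+1 %% k == i)).

Lemma cycle_sym : symmetric cycle_edge.
Proof. by move=> i j; rewrite /cycle_edge eq_sym orbC. Qed.

Lemma cycle_irrefl : irreflexive cycle_edge.
Proof. by move=> i; rewrite /cycle_edge eqxx. Qed.

Definition cycle_graph : sgraph := SGraph cycle_sym cycle_irrefl.

End PathCycle.

Definition contains_induced (H G : sgraph) : Prop :=
  exists2 f : H -> G, injective f & forall x y : H, edge (f x) (f y) = edge x y.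

Definition free2 (H1 H2 G : sgraph) : Prop :=
  ~ contains_induced H1 G /\ ~ contains_induced H2 G.

Section Domination.
Variable G : sgraph.

Definition dominating (X : {set G}) : bool :=
  [forall y : G, (y \notin X) ==> [exists x in X, edge y x]].

Definition connected_dominating (X : {set G}) : bool :=
  dominating X && is_connected (induced X).

Definition gamma : nat :=
  #|[arg min_(X < [set: G] | dominating X) #|X| ]|.

(* Only meaningful for connected G, for which [set: G] qualifies (gamma_cP). *)
Definition gamma_c : nat :=
  #|[arg min_(X < [set: G] | connected_dominating X) #|X| ]|.

Lemma dominatingT : dominating [set: G].
Proof. by apply/forallP => y; rewrite inE. Qed.

Lemma gammaP :
  (exists2 X : {set G}, dominating X & #|X| = gamma) /\
  (forall X : {set G}, dominating X -> gamma <= #|X|).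
Proof.
rewrite /gamma; case: arg_minnP => [|X dX minX]; first exact: dominatingT.
by split; first by exists X.
Qed.

Lemma connected_dominatingT : is_connected G -> connected_dominating [set: G].
Proof.
case/andP=> G_gt0 /forallP Gc; rewrite /connected_dominating dominatingT /=.
pose f (x : G) : induced [set: G] := exist _ x (in_setT x).
have fK (u : induced [set: G]) : f (val u) = u by apply: val_inj.
apply/andP; split; first by case/card_gt0P: G_gt0 => x _; apply/card_gt0P; exists (f x).
apply/forallP=> u; apply/forallP=> v; have /forallP/(_ (val v)) := Gc (val u).
case/connectP=> p pth lastp; apply/connectP; exists (map f p).
  by rewrite -[u in path _ u]fK path_map.
by rewrite -[u in last u _]fK last_map -lastp fK.
Qed.

Lemma gamma_cP : is_connected G ->
  (exists2 X : {set G}, connected_dominating X & #|X| = gamma_c) /\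
  (forall X : {set G}, connected_dominating X -> gamma_c <= #|X|).
Proof.
move=> Gc; rewrite /gamma_c.
case: arg_minnP => [|X dX minX]; first exact: connected_dominatingT.
by split; first by exists X.
Qed.

End Domination.

(* Main.v *)
Require Import Defs.
From mathcomp Require Import all_boot all_order all_algebra.
From mathcomp Require Import zify.

(** Let [D] be a dominating set and [Z] a smallest connected superset of [D];
    every vertex of [Z :\: D] is then a cut vertex of [G[Z]].  If some component
    of [Z - c] lies inside [D], then [c] owns a neighbour in [D] that has no
    other neighbour in [Z :\: D].  Call the remaining vertices of [Z :\: D]
    deep.  A vertex of [D] dominating a deep vertex is owned by nobody, so if
    there are [k > 0] deep vertices, then [#|Z| <= 2 * #|D| + k - 1] and it
    suffices to delete [k - 1] vertices from [Z].

    Each component of [Z - c], for [c] deep, reaches distance at least 2 from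
    [c].  Say that a deep [c] is bad if it has, away from the other deep
    vertices, an induced path with three further vertices hanging from it,
    either inside [Z] or ending in a vertex outside [Z] that has a single
    neighbour in [Z].  Two bad vertices would yield an induced [P_8] or [C_8].
    So all deep vertices but one, [c0], have a component of [Z - c] of radius
    exactly 2 whose vertices at distance 2 from [c] are not needed to dominate
    [G]; deleting one such vertex for each of them keeps [Z] connected, and a
    vertex left undominated by the simultaneous deletions would again produce
    an induced [P_8] or [C_8]. *)

Set Implicit Arguments.
Unset Strict Implicit.
Unset Printing Implicit Defensive.

(** * Induced paths as vertex sequences, and the bounds from excluding [P_8] and [C_8] *)

Section InducedPaths.
Variable G : sgraph.
Implicit Types (x y z : G) (s : seq G).

Fixpoint ipath s : bool :=
  if s is x :: t then
    (if t is y :: u then edge x y && all (fun z => ~~ edge x z && (x != z)) u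
     else true) && ipath t
  else true.

Lemma ipath_edge x0 s i j : ipath s -> i < j < size s ->
  edge (nth x0 s i) (nth x0 s j) = (j == i.+1).
Proof.
elim: s i j => [|x [|y u] IH] i j; [by rewrite andbF|by case: j => [|j]; rewrite /= ?ltn0 ?andbF|].
move=> /= /andP[/andP[xy /allP xu] sP].
case: j => [|j]; first by rewrite ltn0.
case: i => [|i] /andP[ij js]; last by rewrite eqSS -IH //=; apply/andP.
case: j ij js => [|j] ij js //=.
rewrite !ltnS in js; have /andP[/negPf-> _] := xu _ (mem_nth x0 js).
by [].
Qed.

Lemma ipath_uniq s : ipath s -> uniq s.
Proof.
elim: s => [|x [|y u] IH] //= /andP[/andP[xy /allP xu] sP].
apply/andP; split; last exact: IH.
rewrite inE negb_or; apply/andP; split.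
  by apply/eqP=> e; rewrite e edge_irrefl in xy.
by apply/negP=> /xu; rewrite eqxx andbF.
Qed.

Lemma ipath_catl s t : ipath (s ++ t) -> ipath s.
Proof.
elim: s => [|x [|y u] IH] //= /andP[/andP[-> H] /IH] /= ->.
by move: H; rewrite all_cat => /andP[-> _].
Qed.

Lemma ipath_rcons s x z : ipath (rcons s x) -> edge x z ->
  all (fun y => ~~ edge y z && (y != z)) s -> ipath (rcons (rcons s x) z).
Proof.
elim: s => [|a s IH] /=; first by move=> _ ->.
move=> /andP[aP sP] xz /andP[az sz]; rewrite IH // andbT.
by case: s {IH sP sz} aP => [|b s] /= /andP[->]; rewrite ?all_rcons az //= => /andP[-> ->].
Qed.

Hypothesis Gfree : free2 (path_graph 8) (cycle_graph 8) G.

Lemma ipath_size s : ipath s -> size s < 8.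
Proof.
move=> sP; rewrite ltnNge; apply/negP=> s8; case: Gfree => nP _; apply: nP.
have x0 : G by case: s s8 {sP}.
have ts : size (take 8 s) = 8 by rewrite size_takel.
have tP : ipath (take 8 s) by apply: (@ipath_catl _ (drop 8 s)); rewrite cat_take_drop.
exists (fun i : 'I_8 => nth x0 (take 8 s) i).
  by move=> i j /eqP; rewrite nth_uniq ?ts ?ltn_ord ?ipath_uniq // => /eqP/val_inj.
move=> i j /=; rewrite /path_edge.
have [ij|ij|/val_inj->] := ltngtP i j; last by rewrite edge_irrefl gtn_eqF.
- by rewrite ipath_edge ?ts ?ij ?ltn_ord // eq_sym (gtn_eqF (ltnW ij : i < j.+1)) orbF.
- by rewrite edge_sym ipath_edge ?ts ?ij ?ltn_ord // eq_sym (gtn_eqF (ltnW ij : j < i.+1)).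
Qed.

(** If [s] had six vertices, then [x :: rcons s z] would be an induced [C_8] or an induced [P_8],
    according to whether [x] and [z] are adjacent. *)
Lemma ipath_ends x s z : ipath (x :: s) -> ipath (rcons s z) -> x != z -> size s < 6.
Proof.
move=> xs sz xz; rewrite ltnNge; apply/negP=> s6.
have {s6} s6 : size s = 6 by have := ipath_size xs; move=> /=; lia.
have xzE : edge x z.
  apply: contraT => nxz.
  suff /ipath_size : ipath (x :: rcons s z) by rewrite /= size_rcons s6.
  rewrite /= sz andbT; case: s s6 xs {sz} => [|a s] //= _ /andP[/andP[-> xs] _].
  by rewrite all_rcons nxz xz.
case: Gfree => _; apply; pose w := rcons (x :: s) z.
have wl i : i < 7 -> nth x w i = nth x (x :: s) i by move=> i7; rewrite nth_rcons /= s6 i7.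
have wr i : nth x w i.+1 = nth x (rcons s z) i by [].
(* Each pair of positions except 0 and 7 lies in one of the two given paths; that last pair is the
   closing edge of the cycle. *)
have wE i j : i < j < 8 -> edge (nth x w i) (nth x w j) = (j == i.+1) || (i == 0) && (j == 7).
  case/andP=> ij j8; have [j7|j7] := ltnP j 7.
    rewrite !wl ?(ltn_trans ij) // ipath_edge ?ij /= ?s6 //.
    by rewrite (ltn_eqF j7) andbF orbF.
  have -> : j = 7 by apply/eqP; rewrite eqn_leq j7 -ltnS j8.
  case: i ij => [|i] ij; first by rewrite /w rcons_cons /= nth_rcons s6 ltnn eqxx xzE.
  by rewrite !wr ipath_edge ?size_rcons ?s6 ?orbF //; lia.
exists (fun i : 'I_8 => nth x w i).
  move=> i j /eqP; rewrite nth_uniq ?size_rcons /= ?s6 ?ltn_ord //; first by move/eqP/val_inj.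
  rewrite mem_rcons inE negb_or xz /= rcons_uniq.
  have := ipath_uniq xs; have := ipath_uniq sz.
  by rewrite rcons_uniq /= => /andP[-> ->] /andP[-> _].
move=> i j /=; rewrite /cycle_edge.
have [ij|ij|/val_inj->] := ltngtP i j; last by rewrite edge_irrefl eqxx.
- rewrite wE ?ij ?ltn_ord // -val_eqE /= (ltn_eqF ij) /=.
  by have := ltn_ord i; have := ltn_ord j; lia.
- rewrite edge_sym wE ?ij ?ltn_ord // -val_eqE /= (gtn_eqF ij) /=.
  by have := ltn_ord i; have := ltn_ord j; lia.
Qed.

End InducedPaths.

(** * Connectedness of vertex subsets *)

Section Connectedness.
Variable G : sgraph.
Implicit Types (x y z : G) (A Z : {set G}).

Definition edge_in A : rel G := fun x y => [&& x \in A, y \in A & edge x y].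

(** The empty set counts as connected here, unlike for [is_connected]; hence the witness [x] in
    [is_connected_induced]. *)
Definition conn A := [forall x in A, forall y in A, connect (edge_in A) x y].

Lemma edge_in_sym A : connect_sym (edge_in A).
Proof. by apply: sym_connect_sym => x y; rewrite /edge_in andbCA edge_sym. Qed.

Lemma connP A : reflect {in A &, forall x y, connect (edge_in A) x y} (conn A).
Proof.
apply: (iffP forall_inP) => [H x y xA yA|H x xA]; last by apply/forall_inP=> y; apply: H.
by have /forall_inP := H x xA; apply.
Qed.

Lemma conn_root A x : x \in A -> {in A, forall y, connect (edge_in A) x y} -> conn A.
Proof.
move=> xA H; apply/connP=> y z yA zA.
by apply: (connect_trans _ (H z zA)); rewrite edge_in_sym H.
Qed.

Lemma connect_in A x y : connect (edge_in A) x y -> x \in A -> y \in A.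
Proof.
case/connectP=> p; elim: p x => [|z p IH] x /=; first by move=> _ ->.
by case/andP=> /and3P[_ zA _] /IH H yl _; apply: H.
Qed.

Lemma path_edge_in A x p : x \in A -> path edge x p -> {subset p <= A} ->
  path (edge_in A) x p.
Proof.
elim: p x => [|y p IH] x //= xA /andP[xy yp] pA.
have yA : y \in A by apply: pA; rewrite mem_head.
by rewrite /edge_in xA yA xy IH // => z zp; apply: pA; rewrite inE zp orbT.
Qed.

Lemma edge_in_path A x p : path (edge_in A) x p -> path edge x p /\ {subset p <= A}.
Proof.
elim: p x => [|y p IH] x //= /andP[/and3P[_ yA ->] /IH[-> pA]]; split=> // z.
by rewrite inE => /predU1P[->|/pA].
Qed.

Lemma is_connected_induced A x : x \in A -> conn A -> is_connected (induced A).
Proof.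
move=> xA /connP cA; apply/andP; split.
  by apply/card_gt0P; exists (exist _ x xA : induced A).
apply/forallP=> -[y yA]; apply/forallP=> -[z zA].
have /connectP[p yp zl] := cA y z yA zA.
elim: p y yA yp zl => [|w p IH] y yA /=.
  by move=> _ e; apply/eq_connect0/val_inj.
case/andP=> /and3P[_ wA yw] wp zl.
by apply: connect_trans (IH w wA wp zl); apply: connect1.
Qed.

Lemma conn_setT : is_connected G -> conn [set: G].
Proof.
case/andP=> _ /forallP Gc; apply/connP=> x y _ _.
have /forallP/(_ y) := Gc x; apply: connect_sub => a b ab.
by apply: connect1; rewrite /edge_in !inE ab.
Qed.

End Connectedness.

(** * Distances, geodesics and separation inside a connected set *)

Section Distance.
Variables (G : sgraph) (Z : {set G}).
Hypothesis Zc : conn Z.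
Implicit Types (x y z c : G) (p : seq G).

Definition walk n x y := [exists p : n.-tuple G, path (edge_in Z) x p && (last x p == y)].

Lemma walkP n x y :
  reflect (exists p, [/\ path (edge_in Z) x p, last x p = y & size p = n]) (walk n x y).
Proof.
apply: (iffP existsP) => [[p /andP[xp /eqP yl]]|[p [xp yl /eqP sp]]].
  by exists p; rewrite size_tuple.
by exists (Tuple sp); rewrite xp /= yl eqxx.
Qed.

Fact dist_subproof x y : exists n, walk n x y || ~~ connect (edge_in Z) x y.
Proof.
have [/connectP[p xp yl]|_] := boolP (connect _ x y); last by exists 0; rewrite orbT.
by exists (size p); rewrite orbF; apply/walkP; exists p.
Qed.

(* The distance in the subgraph induced by [Z], with junk value 0 on pairs
   that are not connected in [Z]. *)
Definition dist x y := ex_minn (dist_subproof x y).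

Lemma dist_le x p : path (edge_in Z) x p -> dist x (last x p) <= size p.
Proof.
move=> xp; rewrite /dist; case: ex_minnP => n _; apply.
by apply/orP; left; apply/walkP; exists p.
Qed.

Lemma geodesic x y : x \in Z -> y \in Z ->
  exists p, [/\ path (edge_in Z) x p, last x p = y & size p = dist x y].
Proof.
move=> xZ yZ; rewrite /dist; case: ex_minnP => n H _; apply/walkP.
by case/orP: H => // /negP[]; apply: (connP _ Zc).
Qed.

Lemma distxx x : dist x x = 0.
Proof. by apply/eqP; rewrite -leqn0 -[x in dist _ x]/(last x [::]) dist_le. Qed.

Lemma dist_tri x y z : x \in Z -> y \in Z -> z \in Z -> dist x z <= dist x y + dist y z.
Proof.
move=> xZ yZ zZ; have [p [xp yl <-]] := geodesic xZ yZ.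
have [q [yq zl <-]] := geodesic yZ zZ.
by rewrite -size_cat -zl -yl -last_cat dist_le // cat_path xp yl.
Qed.

Lemma distC_le x y : x \in Z -> y \in Z -> dist y x <= dist x y.
Proof.
move=> xZ yZ; have [p [xp yl <-]] := geodesic xZ yZ.
rewrite -(size_belast x) -size_rev -yl.
have {2}-> : x = last (last x p) (rev (belast x p)).
  by case: p {xp yl} => //= a p; rewrite rev_cons last_rcons.
apply: dist_le; rewrite rev_path; apply: sub_path xp => a b.
by rewrite /edge_in andbCA edge_sym.
Qed.

Lemma distC x y : x \in Z -> y \in Z -> dist x y = dist y x.
Proof. by move=> xZ yZ; apply/eqP; rewrite eqn_leq !distC_le. Qed.

Lemma dist_edge x y : x \in Z -> y \in Z -> edge x y -> dist x y <= 1.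
Proof.
move=> xZ yZ xy; rewrite -[y]/(last x [:: y]); apply: (@dist_le x [:: y]).
by rewrite /= /edge_in xZ yZ xy.
Qed.

Lemma dist_eq0 x y : x \in Z -> y \in Z -> (dist x y == 0) = (x == y).
Proof.
move=> xZ yZ; apply/eqP/eqP => [d0|->]; last exact: distxx.
by have [p [_ yl /eqP]] := geodesic xZ yZ; rewrite d0 size_eq0 -yl => /eqP->.
Qed.

Lemma dist_gt0 x y : x \in Z -> y \in Z -> (0 < dist x y) = (x != y).
Proof. by move=> xZ yZ; rewrite lt0n dist_eq0. Qed.


Definition is_geodesic x p := path (edge_in Z) x p && (size p == dist x (last x p)).

(** A chord or a repeated vertex would give a shortcut to the end of the path. *)
Lemma geodesic_ipath x p : x \in Z -> is_geodesic x p -> ipath (x :: p).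
Proof.
elim: p x => [|y p IH] x xZ //= /andP[/= /andP[xy yp] /eqP sp].
have [_ yZ exy] := and3P xy; have [_ pZ] := edge_in_path yp.
have lZ : last y p \in Z by apply: (connect_in _ yZ); apply/connectP; exists p.
have dyp : size p = dist y (last y p).
  apply/eqP; rewrite eqn_leq dist_le // andbT -ltnS sp.
  by rewrite (leq_trans (dist_tri xZ yZ lZ)) // -add1n leq_add2r dist_edge.
apply/andP; split; last by apply: IH => //; rewrite /is_geodesic yp -dyp eqxx.
rewrite exy /=; apply/allP => z zp.
have zZ := pZ z zp; have zl : dist z (last y p) < size p.
  case/path.splitP: zp yp {sp dyp lZ pZ IH} => p1 p2.
  rewrite cat_path last_cat last_rcons size_cat size_rcons => /andP[_ /dist_le d2].
  by apply: leq_ltn_trans d2 _; rewrite addSn ltnS leq_addl.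
have {}sp : (size p).+1 = dist x (last y p) by [].
apply/andP; split; apply/negP.
  by move/(dist_edge xZ zZ); have := dist_tri xZ zZ lZ; lia.
by move/eqP=> exz; rewrite exz in sp; lia.
Qed.

Lemma geodesic_dist x p z : x \in Z -> is_geodesic x p -> z \in x :: p ->
  dist x z + dist z (last x p) = dist x (last x p).
Proof.
move=> xZ /andP[xp /eqP sp] zp.
have [_ pZ] := edge_in_path xp.
have inZ w : w \in x :: p -> w \in Z by rewrite inE => /predU1P[->|/pZ].
have lZ := inZ _ (mem_last x p); have zZ := inZ _ zp.
apply/eqP; rewrite eqn_leq dist_tri // andbT -sp.
case/splitPl: zp xp {sp pZ inZ lZ} => p1 p2 zl; rewrite cat_path last_cat zl size_cat.
by case/andP=> /dist_le; rewrite zl => d1 /dist_le d2; apply: leq_add.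
Qed.

Lemma geodesic_ex x y : x \in Z -> y \in Z ->
  exists p, [/\ is_geodesic x p, last x p = y, size p = dist x y & {subset x :: p <= Z}].
Proof.
move=> xZ yZ; have [p [xp yl sp]] := geodesic xZ yZ.
exists p; split=> //; first by rewrite /is_geodesic xp yl sp /=.
by have [_ pZ] := edge_in_path xp; move=> z; rewrite inE => /predU1P[->|/pZ].
Qed.

Lemma dist_pred x y : x \in Z -> y \in Z -> x != y ->
  exists w, [/\ w \in Z, edge w y & dist x y = (dist x w).+1].
Proof.
move=> xZ yZ xy; have [p [xp yl]] := geodesic xZ yZ.
case/lastP: p xp yl => [|p z]; first by move=> _ /= e; rewrite e eqxx in xy.
rewrite rcons_path last_rcons size_rcons => /andP[xp /and3P[wZ _ wz]] ez sp; subst z.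
exists (last x p); split=> //; apply/eqP; rewrite -sp eqSS eqn_leq dist_le // andbT.
by have := dist_tri xZ wZ yZ; have := dist_edge wZ yZ wz; rewrite -sp; lia.
Qed.

(** Any neighbour [w] of [z] one step closer to the end of [p] will do; it need not lie on [p]. *)
Lemma geodesic_succ x p z : x \in Z -> is_geodesic x p -> z \in x :: p ->
  z != last x p -> exists w, [/\ w \in Z, edge z w & dist x w = (dist x z).+1].
Proof.
move=> xZ gp zp zl; have dz := geodesic_dist xZ gp zp.
have [/edge_in_path[_ pZ] _] := andP gp.
have inZ w : w \in x :: p -> w \in Z by rewrite inE => /predU1P[->|/pZ].
have lZ := inZ _ (mem_last x p); have zZ := inZ _ zp; rewrite eq_sym in zl.
have [w [wZ wz dw]] := dist_pred lZ zZ zl; exists w; split; rewrite 1?edge_sym //.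
have := dist_tri xZ wZ lZ; have := dist_tri xZ zZ wZ.
rewrite (distC wZ lZ) -dz (distC zZ lZ) dw.
by have := dist_edge wZ zZ wz; rewrite (distC wZ zZ); lia.
Qed.


(** Also true when exactly one of [x] and [y] is [c], since no edge of [Z :\ c] leaves [c]. *)
Definition sep c x y := ~~ connect (edge_in (Z :\ c)) x y.

Lemma sepC c x y : sep c x y = sep c y x.
Proof. by rewrite /sep edge_in_sym. Qed.

Lemma sep_connectl c x y z : connect (edge_in (Z :\ c)) x z -> sep c x y = sep c z y.
Proof.
by move=> xz; rewrite /sep (same_connect (@edge_in_sym G (Z :\ c)) xz).
Qed.

(** A geodesic missing [c] would connect [x] and [y] in [Z :\ c]. *)
Lemma sep_dist c x y : x \in Z -> y \in Z -> sep c x y ->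
  dist x y = dist x c + dist c y.
Proof.
move=> xZ yZ sxy; have [p [gp yl _ pZ]] := geodesic_ex xZ yZ.
have [cp|ncp] := boolP (c \in x :: p); first by rewrite -yl (geodesic_dist xZ gp cp).
case/negP: sxy; apply/connectP; exists p => //.
have [xp _] := andP gp; have [{}xp _] := edge_in_path xp.
have inA w : w \in x :: p -> w \in Z :\ c.
  by move=> wp; rewrite !inE pZ // andbT; apply: contraNneq ncp => <-.
by apply: path_edge_in xp _ => [|w wp]; apply: inA; rewrite inE ?eqxx ?wp ?orbT.
Qed.

Lemma connect_avoid c x y : x \in Z -> y \in Z -> dist x y < dist x c + dist c y ->
  connect (edge_in (Z :\ c)) x y.
Proof. by move=> xZ yZ; apply: contraTT => /(sep_dist xZ yZ)->; rewrite ltnn. Qed.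

(** Walks from [w] reach [c] only through [y], so [w] is closer to [y] than to [c] and a geodesic
    from [y] to [w] avoids [c]. *)
Lemma connect_beyond c y w : c \in Z -> y \in Z -> w \in Z -> y != c -> sep y w c ->
  connect (edge_in (Z :\ c)) y w.
Proof.
move=> cZ yZ wZ yc /(sep_dist wZ cZ) dw; apply: connect_avoid => //.
by have := dist_gt0 yZ cZ; rewrite yc; have := distC wZ cZ; have := distC wZ yZ; lia.
Qed.

Lemma sep_beyond c c' h h' : c \in Z -> c' \in Z -> h' \in Z -> c != c' ->
  sep c h c' -> sep c' h' c -> sep c h h'.
Proof.
move=> cZ c'Z h'Z cc' s s'; rewrite sepC -(@sep_connectl c c') 1?sepC //.
by apply: connect_beyond; rewrite // eq_sym.
Qed.

Lemma sep_dist2 c c' h h' : c \in Z -> c' \in Z -> h \in Z -> h' \in Z -> c != c' ->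
  sep c h c' -> sep c' h' c -> dist h h' = dist h c + dist c c' + dist c' h'.
Proof.
move=> cZ c'Z hZ h'Z cc' s s'; rewrite (@sep_dist c) //; last exact: sep_beyond s s'.
rewrite -addnA; congr (_ + _).
by rewrite (distC cZ h'Z) (sep_dist h'Z cZ s') addnC (distC c'Z cZ) (distC h'Z c'Z).
Qed.

End Distance.

Ltac nat_lia :=
  repeat match goal with
  | H : is_true ?b |- _ => lazymatch b with leq _ _ => fail | _ => clear H end
  end; lia.

(** * Deep cut vertices of a minimum connected superset of a dominating set *)

Section MinimumConnectedSuperset.
Variable G : sgraph.
Hypothesis Gfree : free2 (path_graph 8) (cycle_graph 8) G.
Variables D Z : {set G}.
Hypothesis domD : dominating D.
Hypothesis DZ : D \subset Z.
Hypothesis Zc : conn Z.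
Hypothesis Zmin : forall Z' : {set G}, D \subset Z' -> conn Z' -> #|Z| <= #|Z'|.
Implicit Types (c h q r w x y z : G) (p : seq G).

Local Notation dist := (@dist G Z).
Local Notation sep := (@sep G Z).
Local Notation Y := (Z :\: D).

Definition deep : {set G} :=
  [set c in Y | [forall x in Z :\ c, exists y in Y, connect (edge_in (Z :\ c)) x y]].

Lemma deepC c : c \in deep -> c \in Y.
Proof. by rewrite inE => /andP[]. Qed.

Lemma CZ c : c \in Y -> c \in Z.
Proof. by case/setDP. Qed.

Lemma deepZ c : c \in deep -> c \in Z.
Proof. by move/deepC/CZ. Qed.

(** Otherwise [Z :\ c] would be a smaller connected superset of [D]. The vertex [v] names the
    component to stay away from. *)
Lemma connector_cut c v : c \in Y -> v \in Z -> v != c ->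
  exists w, [/\ w \in Z, w != c & sep c w v].
Proof.
move=> cC vZ vc; have vZc : v \in Z :\ c by rewrite !inE vc.
have [cZ cD] := setDP cC.
have [/existsP[w /andP[]]|] := boolP [exists w, (w \in Z :\ c) && sep c w v].
  by rewrite !inE => /andP[wc wZ] s; exists w.
move/existsPn=> H; have sD : D \subset Z :\ c.
  apply/subsetP=> d dD; rewrite !inE (subsetP DZ) // andbT.
  by apply: contraNneq cD => <-.
have cn : conn (Z :\ c).
  apply: (conn_root vZc) => w wZ; have := H w; rewrite wZ /= negbK.
  by rewrite edge_in_sym.
by have := Zmin sD cn; rewrite (cardsD1 c Z) cZ ltnn.
Qed.

(** The component of [x] in [Z - c] contains some [y] in [Y], itself a cut vertex. A vertex cut off
    from [c] by [y] lies in the same component, beyond [y]. *)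
Lemma deep_dist2 c x : c \in deep -> x \in Z -> x != c ->
  exists h, [/\ h \in Z, connect (edge_in (Z :\ c)) x h & 2 <= dist c h].
Proof.
rewrite inE => /andP[cC /forall_inP H] xZ xc.
have xZc : x \in Z :\ c by rewrite !inE xc.
have /exists_inP[y yC xy] := H x xZc.
have /setD1P[yc yZ] := connect_in xy xZc; have cZ := CZ cC.
have [w [wZ wy s]] : exists w, [/\ w \in Z, w != y & sep y w c].
  by apply: connector_cut; rewrite // eq_sym.
exists w; split=> //; first exact: connect_trans xy (connect_beyond Zc _ _ _ yc s).
rewrite (distC Zc cZ wZ) (sep_dist Zc wZ cZ s).
by have := dist_gt0 Zc wZ yZ; have := dist_gt0 Zc yZ cZ; rewrite wy yc; nat_lia.
Qed.

(* [far] also covers the [c] for which every component of [Z - c] contains deep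
   vertices. *)
Definition far c := [forall c' in deep :\ c, exists h in Z, sep c h c' && (2 < dist c h)].

(** Candidates for deletion: [h] is outermost in its component of [Z - c], and [c] separates it from
    every other deep vertex. *)
Definition near c h := [&& h \in Z, dist c h == 2 &
  [forall z, connect (edge_in (Z :\ c)) h z ==> (dist c z <= 2) && (z \notin deep)]].

(** If [c] is not far, some deep [c'] has everything behind [c] within distance 2 of [c]. A
    component of [Z - c] without [c'] then supplies [h]. *)
Lemma far_or_near c : c \in deep -> far c \/ exists h, near c h.
Proof.
move=> cI; have cZ := deepZ cI; have cC := deepC cI.
have [|] := boolP (far c); first by left.
rewrite negb_forall_in => /exists_inP[c' /setD1P[c'c c'I] /exists_inPn H]; right.
have c'Z := deepZ c'I.
have {}H h : h \in Z -> sep c h c' -> dist c h <= 2.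
  by move=> hZ s; have := H h hZ; rewrite s /= -leqNgt.
have [x [xZ xc sx]] := connector_cut cC c'Z c'c.
have [h [hZ xh dh]] := deep_dist2 cI xZ xc; exists h.
have sh : sep c h c' by rewrite -(sep_connectl c' xh).
have hc : h != c by apply/eqP=> e; rewrite e distxx in dh.
apply/and3P; split; rewrite ?eqn_leq ?dh ?H //.
apply/forallP=> z; apply/implyP=> hz.
have /setD1P[zc zZ] : z \in Z :\ c by apply: (connect_in hz); rewrite !inE hc.
have sz : sep c z c' by rewrite -(sep_connectl c' hz).
rewrite H //=; apply/negP=> zI.
(* A deep [z] in this component would have vertices at distance at least 2 behind it, hence at
   distance at least 3 from [c]. *)
have cz : c != z by rewrite eq_sym.
have [w0 [w0Z w0z s0]] := connector_cut (deepC zI) cZ cz.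
have [w [wZ w0w dw]] := deep_dist2 zI w0Z w0z.
have sw : sep z w c by rewrite -(sep_connectl c w0w).
have zw := connect_beyond Zc cZ zZ wZ zc sw.
have := H w wZ; rewrite -(sep_connectl c' zw) => /(_ sz).
rewrite (distC Zc cZ wZ) (sep_dist Zc wZ cZ sw) (distC Zc wZ zZ).
by have := dist_gt0 Zc zZ cZ; rewrite zc; nat_lia.
Qed.

Lemma nearZ c h : near c h -> h \in Z.
Proof. by case/and3P. Qed.

Lemma near_dist c h : near c h -> dist c h = 2.
Proof. by case/and3P=> _ /eqP. Qed.

Lemma near_neq c h : near c h -> h != c.
Proof. by move/near_dist=> d; apply/eqP=> e; rewrite e distxx in d. Qed.

Lemma near_sep c h c' : near c h -> c' \in deep -> sep c h c'.
Proof. by case/and3P=> _ _ /forallP/(_ c') /implyP H c'I; apply/negP=> /H; rewrite c'I andbF. Qed.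

Lemma near_edge c h z : c \in Z -> near c h -> z \in Z -> edge h z ->
  connect (edge_in (Z :\ c)) h z.
Proof.
move=> cZ nh zZ hz; have hZ := nearZ nh; apply: connect1.
rewrite /edge_in !inE near_neq // hZ zZ hz !andbT.
apply/eqP=> e; rewrite e in hz; have := near_dist nh.
by have := dist_edge hZ cZ hz; rewrite (distC Zc hZ cZ); nat_lia.
Qed.

Lemma near_max c h z : near c h -> connect (edge_in (Z :\ c)) h z -> dist c z <= 2.
Proof. by case/and3P=> _ _ /forallP/(_ z) /implyP H /H/andP[]. Qed.

(** Seen from any [r] across [c], the vertex [h] is a local maximum of the distance, so no geodesic
    from [r] continues through [h]. *)
Lemma near_leaf c h r z : c \in Z -> near c h -> r \in Z -> sep c h r ->
  z \in Z -> edge h z -> dist r z <= dist r h.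
Proof.
move=> cZ nh rZ s zZ hz; have hZ := nearZ nh.
have cz := near_edge cZ nh zZ hz.
have sz : sep c z r by rewrite -(sep_connectl r cz).
rewrite (distC Zc rZ zZ) (distC Zc rZ hZ) (sep_dist Zc zZ rZ sz) (sep_dist Zc hZ rZ s).
rewrite leq_add2r (distC Zc hZ cZ) (distC Zc zZ cZ) (near_dist nh).
exact: near_max nh cz.
Qed.

(** Outside [D], [h] would be a cut vertex, with vertices behind it at distance more than 2 from
    [c]. *)
Lemma near_D c h : c \in Z -> near c h -> h \in D.
Proof.
move=> cZ nh; have hZ := nearZ nh; apply: contraT => hD.
have hC : h \in Y by rewrite inE hD.
have ch : c != h by rewrite eq_sym (near_neq nh).
have [w [wZ wh s]] := connector_cut hC cZ ch.
have hw := connect_beyond Zc cZ hZ wZ (near_neq nh) s.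
have := near_max nh hw; rewrite (distC Zc cZ wZ) (sep_dist Zc wZ cZ s).
by rewrite (distC Zc hZ cZ) (near_dist nh); have := dist_gt0 Zc wZ hZ; rewrite wh; nat_lia.
Qed.

Lemma near_inj c c' h : c \in deep -> c' \in deep -> near c h -> near c' h -> c = c'.
Proof.
move=> cI c'I nh nh'; apply/eqP/contraT => cc'; have cZ := deepZ cI; have c'Z := deepZ c'I.
have hZ := nearZ nh.
have := sep_dist2 Zc cZ c'Z hZ hZ cc' (near_sep nh c'I) (near_sep nh' cI).
by rewrite distxx (distC Zc hZ cZ) (near_dist nh); nat_lia.
Qed.

(** * At most one deep vertex is bad *)

Definition capped h :=
  [exists q, [&& q \notin Z, edge q h & [forall z in Z, edge q z ==> (z == h)]]].

Lemma ipath_cons_notin q h p : q \notin Z -> ipath (h :: p) -> {subset h :: p <= Z} ->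
  edge q h -> {in p, forall z, ~~ edge q z} -> ipath (q :: h :: p).
Proof.
move=> qZ hp pZ qh qp; rewrite /= qh; apply/andP; split; last exact: hp.
apply/allP=> z zp; rewrite qp //=; apply: contraNneq qZ => ->.
by rewrite pZ // inE zp orbT.
Qed.

Lemma ipath_rcons_notin q h p : q \notin Z -> ipath (h :: p) -> {subset h :: p <= Z} ->
  edge q (last h p) -> {in h :: p, forall z, edge q z -> z = last h p} ->
  ipath (rcons (h :: p) q).
Proof.
rewrite lastI => qZ hp pZ ql qp; apply: ipath_rcons => //; first by rewrite edge_sym.
have := ipath_uniq hp; rewrite rcons_uniq => /andP[lb _].
apply/allP=> y yb; have yp : y \in rcons (belast h p) (last h p).
  by rewrite mem_rcons inE yb orbT.
apply/andP; split; last by apply: contraNneq qZ => <-; apply: pZ.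
by rewrite edge_sym; apply: contraNN lb => /(qp _ yp) <-.
Qed.

(** The obstructions to a deletion at [c]: a vertex that is not far has a [near] vertex, and
    deleting a capped one would leave its private neighbour outside [Z] undominated. *)
Definition bad c := far c || [exists h, near c h && capped h].

Lemma bad_end c c' : c \in deep -> c' \in deep -> c != c' -> bad c ->
  exists h, [/\ h \in Z, sep c h c' & 2 < dist c h \/ 2 <= dist c h /\ capped h].
Proof.
move=> cI c'I cc' /orP[/forall_inP/(_ c')|/existsP[h /andP[nh hq]]].
  rewrite in_setD1 eq_sym cc' c'I => /(_ isT)/exists_inP[h hZ /andP[s d]].
  by exists h; split=> //; left.
exists h; split; [exact: nearZ nh|exact: near_sep|right].
by rewrite (near_dist nh).
Qed.

(** A geodesic preceded by the private neighbour of [x] is an induced path on [dist x y + 2]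
    vertices. *)
Lemma dist_capped x y : x \in Z -> y \in Z -> capped x -> dist x y < 6.
Proof.
move=> xZ yZ /existsP[q /and3P[qZ qx /forall_inP qP]].
have [p [gp yl sp pZ]] := geodesic_ex Zc xZ yZ.
have ip := geodesic_ipath Zc xZ gp.
have /andP[xp _] := ipath_uniq ip.
have /(ipath_size Gfree) : ipath (q :: x :: p).
  apply: ipath_cons_notin => // z zp; apply/negP=> qz.
  have := qP z; rewrite pZ ?inE ?zp ?orbT // qz => /(_ isT) /eqP e.
  by rewrite -e zp in xp.
by rewrite /= sp.
Qed.

Lemma dist_lt7 x y : x \in Z -> y \in Z -> dist x y < 7.
Proof.
move=> xZ yZ; have [p [gp yl <- _]] := geodesic_ex Zc xZ yZ.
exact: (ipath_size Gfree (geodesic_ipath Zc xZ gp)).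
Qed.

(** The private neighbours of [x] and [y] extend a geodesic at both ends. They may be adjacent to
    each other, which is why [ipath_ends] is used. *)
Lemma dist_capped2 x y : x \in Z -> y \in Z -> x != y -> capped x -> capped y ->
  dist x y < 5.
Proof.
move=> xZ yZ xy /existsP[q /and3P[qZ qx /forall_inP qP]].
move=> /existsP[r /and3P[rZ ry /forall_inP rP]].
have [p [gp yl sp pZ]] := geodesic_ex Zc xZ yZ.
have ip := geodesic_ipath Zc xZ gp.
have /andP[xp _] := ipath_uniq ip.
have iq : ipath (q :: x :: p).
  apply: ipath_cons_notin => // z zp; apply/negP=> qz.
  have := qP z; rewrite pZ ?inE ?zp ?orbT // qz => /(_ isT) /eqP e.
  by rewrite -e zp in xp.
have ir : ipath (rcons (x :: p) r).
  apply: ipath_rcons_notin; rewrite ?yl // => z zp rz.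
  by apply/eqP; have := rP z (pZ z zp); rewrite rz.
have qr : q != r.
  by apply/eqP=> e; have := rP x xZ; rewrite -e qx (negPf xy).
by have := ipath_ends Gfree iq ir qr; rewrite /= sp.
Qed.

(** The ends [h] and [h'] lie on opposite sides of [c] and [c']. With zero, one or two capped ends
    their distance is at least 7, 6 or 5, against the bounds 6, 5 and 4. *)
Lemma bad_unique c c' : c \in deep -> c' \in deep -> bad c -> bad c' -> c = c'.
Proof.
move=> cI c'I bc bc'; apply/eqP/contraT => cc'.
have cZ := deepZ cI; have c'Z := deepZ c'I.
have [h [hZ s H]] := bad_end cI c'I cc' bc.
have c'c : c' != c by rewrite eq_sym.
have [h' [h'Z s' H']] := bad_end c'I cI c'c bc'.
have := sep_dist2 Zc cZ c'Z hZ h'Z cc' s s'; rewrite (distC Zc hZ cZ).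
have := dist_gt0 Zc cZ c'Z; rewrite cc'.
have := dist_lt7 hZ h'Z; have := distC Zc hZ h'Z.
case: H => [d|[d k]]; case: H' => [d'|[d' k']]; first nat_lia.
- by have := dist_capped h'Z hZ k'; nat_lia.
- by have := dist_capped hZ h'Z k; nat_lia.
have [e|hh'] := eqVneq h h'; first by rewrite e distxx; nat_lia.
by have := dist_capped2 hZ h'Z hh' k k'; nat_lia.
Qed.

(** * Counting the vertices of [Y] that are not deep *)

Lemma outer_private c : c \in Y -> c \notin deep ->
  exists d, [/\ d \in D, edge d c & {in Y, forall c', edge d c' -> c' = c}].
Proof.
move=> cY; have cZ := CZ cY.
rewrite inE cY /= => /forallPn[x]; rewrite negb_imply => /andP[/setD1P[xc xZ] /exists_inPn H].
(* The component of [x] in [Z - c] avoids [Y]. It contains [d], so [d] is in [D], and it would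
   contain any neighbour of [d] in [Y] other than [c]. *)
have [d [dZ dc dx]] := dist_pred Zc xZ cZ xc.
have dnc : d != c by apply: contraTneq dc => ->; rewrite edge_irrefl.
have xd : connect (edge_in (Z :\ c)) x d.
  by apply: connect_avoid => //; rewrite dx addSn ltnS leq_addr.
exists d; split=> //.
  by apply: contraT => dD; have := H d; rewrite inE dD dZ xd => /(_ isT).
move=> c' c'Y dc'; apply/eqP/contraT => c'c; have /negP[] := H c' c'Y.
apply: connect_trans xd (connect1 _).
by rewrite /edge_in !inE dnc c'c dZ (CZ c'Y).
Qed.

(** Choosing an owned vertex for each [c] is injective, since an owned vertex has only one neighbour
    in [Y]. The set [E] is [D], or [D] without a vertex known to be owned by nobody. *)
Lemma outer_card_le (E : {set G}) :
  (forall c d, c \in Y :\: deep -> d \in D -> edge d c ->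
    {in Y, forall c', edge d c' -> c' = c} -> d \in E) -> #|Y :\: deep| <= #|E|.
Proof.
pose P c d := [&& d \in D, edge d c & [forall c' in Y, edge d c' ==> (c' == c)]].
pose f c := odflt c [pick d | P c d].
have fP c : c \in Y :\: deep -> P c (f c).
  case/setDP=> cY cI; rewrite /f; case: pickP => //= noP.
  have [d [dD dc H]] := outer_private cY cI; case/negP: (noP d); rewrite /P dD dc.
  by apply/forall_inP=> c' c'Y; apply/implyP=> /H->.
move=> HE; rewrite -(card_in_imset (f := f)) => [|c c' cO c'O ff'].
  apply/subset_leq_card/subsetP=> _ /imsetP[c cO ->].
  have /and3P[fD fc /forall_inP H] := fP c cO; apply: HE fc _ => // c' c'Y.
  by move/(implyP (H c' c'Y))/eqP.
have /and3P[_ fc _] := fP c cO; have /and3P[_ _ /forall_inP/(_ c)] := fP c' c'O.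
by rewrite -ff' fc; case/setDP: cO => -> _ /(_ isT) /eqP.
Qed.

Lemma card_minimum : #|Z| = #|D| + #|Y :\: deep| + #|deep|.
Proof.
rewrite -(cardsID D Z) (setIidPr DZ) -(cardsID deep Y) (setIidPr _); last first.
  by apply/subsetP=> c /deepC.
by rewrite -addnA (addnC #|deep|).
Qed.

Lemma outer_card : #|Y :\: deep| <= #|D|.
Proof. exact: outer_card_le. Qed.

(** A vertex [d0] dominating [c0] could only be owned by [c0], which is deep. *)
Lemma outer_card_lt c0 : c0 \in deep -> #|Y :\: deep| < #|D|.
Proof.
move=> c0I; have c0Y := deepC c0I; have [_ c0D] := setDP c0Y.
have := forallP domD c0; rewrite c0D => /exists_inP[d0 d0D cd0].
rewrite (cardsD1 d0 D) d0D ltnS; apply: outer_card_le => c d cO dD dc H.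
rewrite !inE dD andbT; apply: contraTneq cO => e.
by rewrite -(H c0 c0Y) ?e 1?edge_sym // inE c0I.
Qed.

Lemma near_near_sep c c' h h' : c \in deep -> c' \in deep -> c != c' ->
  near c h -> near c' h' -> sep c h h'.
Proof.
move=> cI c'I cc' nh nh'.
exact: (sep_beyond Zc (deepZ cI) (deepZ c'I) (nearZ nh') cc' (near_sep nh c'I) (near_sep nh' cI)).
Qed.

(** * Deleting one tip for each deep vertex other than [c0] *)

Section Drop.
Variable c0 : G.
Hypothesis c0I : c0 \in deep.
Variable tip : G -> G.
Hypothesis tipN : {in deep :\ c0, forall c, near c (tip c)}.
Hypothesis tip_capped : {in deep :\ c0, forall c, ~~ capped (tip c)}.

Local Notation B := (tip @: (deep :\ c0)).

Let c0Z : c0 \in Z := deepZ c0I.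

Lemma tip_leaf c r z : c \in deep :\ c0 -> r \in Z -> sep c (tip c) r ->
  z \in Z -> edge (tip c) z -> dist r z <= dist r (tip c).
Proof.
move=> cI; have /setD1P[_ /deepZ cZ] := cI.
exact: near_leaf (tipN cI).
Qed.

(** The predecessor of [z] on the way to [c0] is no tip, because tips are local maxima of the
    distance from [c0]. This yields both connectedness and domination inside [Z]. *)
Lemma drop_pred z : z \in Z -> z != c0 ->
  exists w, [/\ w \in Z :\: B, edge w z & dist c0 z = (dist c0 w).+1].
Proof.
move=> zZ; rewrite eq_sym => zc; have [w [wZ wz dw]] := dist_pred Zc c0Z zZ zc.
exists w; split=> //; rewrite inE wZ andbT; apply/imsetP=> -[c cI e].
have s := near_sep (tipN cI) c0I; rewrite e in wz dw.
by have := tip_leaf cI c0Z s zZ wz; rewrite dw ltnn.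
Qed.

Lemma c0_drop : c0 \in Z :\: B.
Proof.
rewrite inE c0Z andbT; apply/imsetP=> -[c cI e].
have /setD1P[_ /deepZ cZ] := cI.
by have := near_D cZ (tipN cI); rewrite -e; have /setDP[_ /negPf->] := deepC c0I.
Qed.

Lemma drop_conn : conn (Z :\: B).
Proof.
apply: (conn_root c0_drop) => z; move dz: (dist c0 z) => n.
elim: n z dz => [|n IH] z dz zZ'; have /setDP[zZ _] := zZ'.
  by move/eqP: dz; rewrite dist_eq0 // => /eqP->.
have zc : z != c0 by apply/eqP=> e; rewrite e distxx in dz.
have [w [wZ' wz dw]] := drop_pred zZ zc.
apply: connect_trans (IH w _ wZ') (connect1 _); first by move: dw; rewrite dz => -[].
by rewrite /edge_in wZ' zZ' wz.
Qed.

Lemma tip_inj : {in deep :\ c0 &, injective tip}.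
Proof.
move=> c c' cI c'I e; have nc := tipN cI; have nc' := tipN c'I; rewrite -e in nc'.
by case/setD1P: cI => _ cI; case/setD1P: c'I => _ c'I; apply: near_inj nc nc'.
Qed.

(** The deletions account for all deep vertices but [c0], and the strict inequality of
    [outer_card_lt] pays for [c0]. *)
Lemma drop_card : #|Z :\: B| <= 2 * #|D|.
Proof.
have BZ : B \subset Z by apply/subsetP=> _ /imsetP[c cI ->]; apply: nearZ (tipN cI).
rewrite cardsD (setIidPr BZ) (card_in_imset tip_inj) card_minimum.
rewrite (cardsD1 c0 deep) c0I; have := outer_card_lt c0I.
move: #|Y :\: deep| #|D| #|deep :\ c0|; clear; lia.
Qed.

(* A vertex [q] left undominated sees two tips; a geodesic from one of them to
   the far side of [c0], extended through [q], is then too long. *)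
Lemma drop_dominated q : q \notin Z -> exists2 z, z \in Z :\: B & edge q z.
Proof.
move=> qZ; have [/exists_inP//|/exists_inPn qB] := boolP [exists z in Z :\: B, edge q z].
(* All neighbours of [q] in [Z] are tips. There is one in [D], and a second one because that tip is
   not capped. *)
exfalso; have {}qB z : z \in Z -> edge q z -> exists2 c, c \in deep :\ c0 & z = tip c.
  move=> zZ qz; apply/imsetP; apply: contraT => zB.
  by have := qB z; rewrite inE zB zZ qz => /(_ isT).
have [h1 h1D qh1] : exists2 z, z \in D & edge q z.
  have qD : q \notin D by apply: contraNN qZ => /(subsetP DZ).
  by have := forallP domD q; rewrite qD => /exists_inP.
have h1Z := subsetP DZ _ h1D; have [c1 c1I' e1] := qB _ h1Z qh1.
have [h2 [h2Z qh2 h12]] : exists h, [/\ h \in Z, edge q h & h != h1].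
  have /existsPn/(_ q) := tip_capped c1I'; rewrite -e1 qZ qh1 /= => /forallPn[h].
  by rewrite !negb_imply => /and3P[hZ qh hh]; exists h.
have [c2 c2I' e2] := qB _ h2Z qh2.
have c12 : c1 != c2 by apply: contraNneq h12 => e; rewrite e1 e2 e.
have n1 := tipN c1I'; have n2 := tipN c2I'; rewrite -e1 in n1; rewrite -e2 in n2.
have /setD1P[c10 c1I] := c1I'; have /setD1P[c20 c2I] := c2I'.
have c1Z := deepZ c1I; have c2Z := deepZ c2I; have c01 : c0 != c1 by rewrite eq_sym.
have c21 : c2 != c1 by rewrite eq_sym.
have d1 : dist c1 h1 = 2 := near_dist n1.
have d01 : 0 < dist c0 c1 by rewrite dist_gt0.
(* A neighbour [z] of [q] inside the geodesic would be a tip, yet the geodesic moves on to a vertex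
   farther from [h1], against [tip_leaf]. *)
have inner p z : is_geodesic Z h1 p -> z \in p -> z != last h1 p -> ~~ edge q z.
  move=> gp zp zl; apply/negP=> qz.
  have ip := geodesic_ipath Zc h1Z gp; have /andP[h1p _] := ipath_uniq ip.
  have zp' : z \in h1 :: p by rewrite inE zp orbT.
  have [w [wZ zw dw]] := geodesic_succ Zc h1Z gp zp' zl.
  have [/andP[/edge_in_path[_ pZ] _]] := (gp); have zZ := pZ _ zp.
  have [c cI' e] := qB z zZ qz; have /setD1P[_ cI] := cI'.
  have cc1 : c != c1 by apply: contraNneq h1p => ec; rewrite e1 -ec -e.
  have s := near_near_sep cI c1I cc1 (tipN cI') n1; rewrite e in zw dw.
  by have := tip_leaf cI' h1Z s wZ zw; rewrite dw ltnn.
have [f0|[h0 n0]] := far_or_near c0I.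
  have /exists_inP[h0 h0Z /andP[s0 d0]] := forall_inP f0 c1 c1I'.
  have [p [gp pl sp pZ]] := geodesic_ex Zc h1Z h0Z.
  have ip := geodesic_ipath Zc h1Z gp.
  (* The distance is at least 2 + 1 + 3. If [q] misses [h0], prepending [q] gives a path on at least
     8 vertices; otherwise [ipath_ends] applies to the ends [h1] and [q]. *)
  have p6 : 6 <= size p.
    rewrite sp (distC Zc h1Z h0Z) (sep_dist2 Zc c0Z c1Z h0Z h1Z c01 s0 (near_sep n1 c0I)).
    by rewrite (distC Zc h0Z c0Z) d1; move: d0 d01; clear; lia.
  have [qh0|qh0] := boolP (edge q h0); last first.
    have /(ipath_size Gfree) : ipath (q :: h1 :: p).
      apply: ipath_cons_notin => // z zp.
      by have [->|zl] := eqVneq z (last h1 p); [rewrite pl|apply: inner gp zp zl].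
    by rewrite /= !ltnS leqNgt p6.
  have h1q : h1 != q by apply: contraNneq qZ => <-.
  have iq : ipath (rcons p q).
    case: p gp pl ip pZ {sp p6} => [|a p] gp pl ip pZ //.
    apply: ipath_rcons_notin => //; last 2 first.
    - by rewrite -[last a p]/(last h1 (a :: p)) pl.
    - move=> z zp qz; apply/eqP; apply: contraLR qz => zl; exact: inner gp zp zl.
    - by case/andP: ip.
    - by move=> z zp; apply: pZ; rewrite inE zp orbT.
  by have := ipath_ends Gfree ip iq h1q; rewrite ltnNge p6.
have h0Z := nearZ n0; have [p [gp pl sp pZ]] := geodesic_ex Zc h1Z h0Z.
have ip := geodesic_ipath Zc h1Z gp.
(* Now the distance is only at least 2 + 1 + 2, and the second tip [h2] supplies the missing eighth
   vertex. *)
have p5 : 5 <= size p.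
  rewrite sp (sep_dist2 Zc c1Z c0Z h1Z h0Z c10 (near_sep n1 c0I) (near_sep n0 c1I)).
  rewrite (distC Zc h1Z c1Z) d1 (near_dist n0) (distC Zc c1Z c0Z).
  by move: d01; clear; lia.
have qh0 : ~~ edge q h0.
  apply/negP=> qh0; have [c cI e] := qB _ h0Z qh0; have n := tipN cI; rewrite -e in n.
  by case/setD1P: cI => /eqP nc cI; case: nc; apply: near_inj n n0.
have iq : ipath (q :: h1 :: p).
  apply: ipath_cons_notin => // z zp.
  by have [->|zl] := eqVneq z (last h1 p); [rewrite pl|apply: inner gp zp zl].
(* A geodesic visiting the component of [h2] in [Z - c2] would pass [c2] both on entering and on
   leaving. *)
have h2p z : z \in h1 :: p -> ~~ connect (edge_in (Z :\ c2)) h2 z.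
  move=> zp; apply/negP=> h2z; have zZ := pZ z zp.
  have /setD1P[zc2 _] : z \in Z :\ c2.
    by apply: (connect_in h2z); rewrite !inE (near_neq n2) h2Z.
  have := near_near_sep c2I c1I c21 n2 n1; have := near_near_sep c2I c0I c20 n2 n0.
  rewrite !(sep_connectl _ h2z) => /(sep_dist Zc zZ h0Z) e0 /(sep_dist Zc zZ h1Z) e1'.
  have := geodesic_dist Zc h1Z gp zp; rewrite pl.
  have := dist_tri Zc h1Z c2Z h0Z; have := dist_gt0 Zc zZ c2Z; rewrite zc2.
  rewrite (distC Zc h1Z zZ) e0 e1' (distC Zc h1Z c2Z).
  move: (dist z c2) (dist c2 h1) (dist c2 h0) (dist h1 h0); clear; lia.
have /(ipath_size Gfree) : ipath (h2 :: q :: h1 :: p).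
  apply/andP; split; last exact: iq.
  rewrite edge_sym qh2 andTb; apply/allP=> z zp; have nz := h2p z zp.
  apply/andP; split; last by apply: contraNneq nz => <-; apply: connect0.
  by apply: contraNN nz; apply: near_edge => //; apply: pZ.
by rewrite /= !ltnS leqNgt p5.
Qed.

Lemma drop_dominating : dominating (Z :\: B).
Proof.
apply/forallP=> q; apply/implyP=> qZ'; apply/exists_inP.
have [qZ|qZ] := boolP (q \in Z); last exact: drop_dominated.
have qc : q != c0 by apply: contraNneq qZ' => ->; apply: c0_drop.
by have [w [wZ' wq _]] := drop_pred qZ qc; exists w; rewrite // edge_sym.
Qed.

End Drop.

Lemma connected_dominating_minimum :
  exists2 X : {set G}, dominating X && conn X & #|X| <= 2 * #|D|.
Proof.
(* Without deep vertices [Z] itself is small enough. *)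
have [e|[c1 c1I]] := set_0Vmem deep.
  exists Z; last first.
    by rewrite card_minimum e cards0 addn0 mul2n -addnn leq_add2l -e outer_card.
  rewrite Zc andbT; apply/forallP=> q; apply/implyP=> qZ.
  have qD : q \notin D by apply: contraNN qZ => /(subsetP DZ).
  have := forallP domD q; rewrite qD => /exists_inP[d dD qd].
  by apply/exists_inP; exists d; rewrite ?(subsetP DZ).
(* Take the bad vertex for [c0] if there is one, and any deep vertex otherwise. *)
have [c0 c0I good] : exists2 c0, c0 \in deep & {in deep :\ c0, forall c, ~~ bad c}.
  have [/exists_inP[c0 c0I b0]|/exists_inPn nb] := boolP [exists c in deep, bad c].
    exists c0 => // c /setD1P[cc0 cI]; apply: contra cc0 => bc.
    by apply/eqP; apply: bad_unique.
  by exists c1 => // c /setD1P[_ /nb].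
(* The default [c] is never taken on [deep :\ c0], whose members are not far and so have a [near]
   vertex. *)
pose tip c := odflt c [pick h | near c h].
have tipN : {in deep :\ c0, forall c, near c (tip c)}.
  move=> c cI; have := good c cI; rewrite negb_or => /andP[nf _].
  have /setD1P[_ /far_or_near[f|[h nh]]] := cI; first by rewrite f in nf.
  by rewrite /tip; case: pickP => //= /(_ h); rewrite nh.
have tip_capped : {in deep :\ c0, forall c, ~~ capped (tip c)}.
  move=> c cI; have := good c cI; rewrite negb_or => /andP[_ /existsPn/(_ (tip c))].
  by rewrite tipN.
exists (Z :\: tip @: (deep :\ c0)); last exact: drop_card.
by rewrite drop_dominating ?drop_conn.
Qed.
End MinimumConnectedSuperset.

(** * From a minimum connected superset to the bound on [gamma_c] *)

Lemma small_connected_dominating (G : sgraph) (D : {set G}) :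
  is_connected G -> free2 (path_graph 8) (cycle_graph 8) G -> dominating D ->
  exists2 X : {set G}, connected_dominating X & #|X| <= 2 * #|D|.
Proof.
move=> Gc Gfree domD; pose P (Z : {set G}) := (D \subset Z) && conn Z.
have PT : P setT by rewrite /P subsetT conn_setT.
case: (arg_minnP (fun Z : {set G} => #|Z|) PT) => Z /andP[DZ Zc] Zmin.
have Zmin' (Z' : {set G}) : D \subset Z' -> conn Z' -> #|Z| <= #|Z'|.
  by move=> DZ' cZ'; apply: Zmin; rewrite /P DZ'.
have [X /andP[domX cX] Xle] := connected_dominating_minimum Gfree domD DZ Zc Zmin'.
exists X => //; rewrite /connected_dominating domX.
(* [X] is nonempty: it contains or dominates a vertex of the nonempty [G]. *)
case/andP: Gc => /card_gt0P[x _] _.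
have [xX|xX] := boolP (x \in X); first exact: is_connected_induced xX cX.
have := forallP domX x; rewrite xX => /exists_inP[y yX _].
exact: is_connected_induced yX cX.
Qed.

Theorem theorem3 (G : sgraph) (Gconn : is_connected G)
    (Gfree : free2 (path_graph 8) (cycle_graph 8) G) :
  ((gamma_c G)%:R / (gamma G)%:R <= 2 :> rat)%R.
Proof.
have [[D domD eD] _] := gammaP G; have [_ Xmin] := gamma_cP Gconn.
have [X cdX] := small_connected_dominating Gconn Gfree domD; rewrite eD => Xle.
(* If [gamma G] is 0, the quotient is 0 by the convention for division by zero. *)
have [->|g0] := posnP (gamma G); first by rewrite GRing.invr0 GRing.mulr0.
rewrite Num.Theory.ler_pdivrMr ?Num.Theory.ltr0n // -GRing.natrM Num.Theory.ler_nat.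
exact: leq_trans (Xmin X cdX) Xle.
Qed.
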